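(* For any integers $a\ge 1$, $b\ge 0$ and $c\ge 2$, let $n=a+b+c-1$. Then the chromatic symmetric function of the clique-path-cycle graph $P^b(K_a,C_c)$ satisfies \[ X_{P^b(K_a,\,C_c)}=(a-1)!\sum_{K\vDash n} c_K\, w_K\, e_K, \] where the sum runs over all compositions $K=k_1k_2\dotsm k_\ell$ of $n$ and \[ c_K=\begin{cases} 0, & \text{if } \ell(K)\ge 2 \text{ and } k_2<a,\\[2pt] \displaystyle k_2-a-b+\frac{k_2-k_1}{k_2-1}, & \text{if } k_1\le a-1 \text{ and } k_2\ge a+b,\\[2pt] \Theta_K(a+b), & \text{otherwise} \end{cases} \] (the cases are applied in the order listed). Moreover every coefficient $(a-1)!\,c_K w_K$ is nonnegative; in particular $X_{P^b(K_a,C_c)}$ is $e$-positive.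
   Context: All graphs are finite simple graphs. The chromatic symmetric function of a graph $G$ is $X_G=\sum_{\kappa}\prod_{v\in V(G)}x_{\kappa(v)}$, where $\kappa$ ranges over proper colorings $\kappa:V(G)\to\{1,2,\dots\}$. $e_k$ denotes the $k$-th elementary symmetric function; a symmetric function is $e$-positive if its expansion in the basis $\{e_\lambda\}$ has nonnegative coefficients. $K_a$ is the complete graph on $a$ vertices, $C_c$ is the cycle on $c$ vertices for $c\ge 3$, and $C_2:=K_2$. For rooted graphs $(G,u)$, $(H,v)$ and an integer $k\ge 0$, the path-conjoined graph $P^k(G,H)$ is obtained from the disjoint union of $G$ and $H$ by adding a path of length $k$ (with $k-1$ new internal vertices) joining $u$ and $v$ (for $k=0$, $u$ and $v$ are identified). Cliques and cycles are vertex-transitive, so their root may be any vertex. A composition $K=k_1\dotsm k_\ell$ of $n$ (written $K\vDash n$) is a sequence of positive integers with sum $n$, with length $\ell(K)=\ell$. Define $e_K=e_{k_1}e_{k_2}\dotsm e_{k_\ell}$ and $w_K=k_1(k_2-1)(k_3-1)\dotsm(k_\ell-1)$. For a number $t\le n$, $\sigma_K(t)=\min\{k_1+\dots+k_j: 0\le j\le \ell(K),\ k_1+\dots+k_j\ge t\}$ and $\Theta_K(t)=\sigma_K(t)-t$. *)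

(* Defs.v *)
From HB Require Import structures.
From mathcomp Require Import all_boot all_order all_algebra.
From mathcomp Require Import mpoly.
Set Implicit Arguments. Unset Strict Implicit. Unset Printing Implicit Defensive.
Import Order.TTheory GRing.Theory Num.Theory.
Local Open Scope ring_scope.

Definition proper_coloring (V : finType) (adj : rel V) (N : nat)
  (k : {ffun V -> 'I_N}) : bool :=
  [forall u, forall v, adj u v ==> (k u != k v)].

(* The chromatic symmetric function X_G specialised to N variables
   x_0, ..., x_{N-1}: sum over proper colourings kappa : V -> 'I_N of
   prod_v x_{kappa v}.  (An identity of symmetric functions of degree n
   holds iff it holds in N variables for every N.) *)
Definition chrom_sym (V : finType) (adj : rel V) (N : nat) : {mpoly rat[N]} :=
  \sum_(k : {ffun V -> 'I_N} | proper_coloring adj k) \prod_(v : V) 'X_(k v).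

(* Vertex set 'I_n with n = a + b + c - 1, labelled as follows:
   - 0, ..., a-1           : the clique K_a, with root a-1;
   - a-1, a, ..., a+b-1    : the path of length b joining the clique root
                             a-1 to the cycle root a+b-1
                             (internal vertices a, ..., a+b-2);
   - a+b-1, ..., a+b+c-2   : the cycle C_c (c vertices, consecutive ones
                             adjacent, plus the closing edge between the
                             first and the last; for c = 2 this closing
                             edge coincides with the single edge, so C_2 = K_2).
   For b = 0 the two roots coincide (vertex a-1). *)
Definition cpc_edge (a b c : nat) (i j : nat) : bool := (
  [&& i < a, j < a & i != j]
  || [&& j == i.+1, a.-1 <= i & i < a + b - 1]
  || [&& j == i.+1, a + b - 1 <= i & j <= a + b + c - 2]
  || [&& 3 <= c, i == a + b - 1 & j == a + b + c - 2])%N.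
Arguments cpc_edge a b c i j : clear scopes.

Definition cpc_adj (a b c : nat) : rel 'I_(a + b + c - 1) :=
  fun u v => (u != v) && (cpc_edge a b c u v || cpc_edge a b c v u).
Arguments cpc_adj : clear implicits.

Definition is_composition (n : nat) (K : seq nat) : bool :=
  all (fun k => 0 < k)%N K && (sumn K == n).

(* Sum of F K over all compositions K of n.  Every composition of n has
   length <= n and parts <= n, so it is enumerated (exactly once) as a
   tuple of length l <= n with entries in 'I_n.+1. *)

Definition sum_comp (N n : nat) (F : seq nat -> {mpoly rat[N]}) : {mpoly rat[N]} :=
  \sum_(l < n.+1)
    \sum_(t : l.-tuple 'I_n.+1 | is_composition n [seq val i | i <- t])
       F [seq val i | i <- t].

Definition eK (N : nat) (K : seq nat) : {mpoly rat[N]} :=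
  \prod_(k <- K) mesym N rat k.

Definition wK (K : seq nat) : nat :=
  match K with
  | [::] => 1
  | k1 :: t => k1 * \prod_(k <- t) (k - 1)
  end%N.

(* sigma_K(t) = min { k_1 + ... + k_j : 0 <= j <= l(K), k_1+...+k_j >= t }
   (the default value sumn K is attained at j = l(K) whenever t <= sumn K). *)
Definition sigmaK (K : seq nat) (t : nat) : nat :=
  \big[minn/sumn K]_(j < (size K).+1 | (t <= sumn (take j K))%N) sumn (take j K).

Definition ThetaK (K : seq nat) (t : nat) : nat := (sigmaK K t - t)%N.

Definition cK (a b : nat) (K : seq nat) : rat :=
  let k1 := nth 0%N K 0 in
  let k2 := nth 0%N K 1 in
  if (2 <= size K)%N && (k2 < a)%N then 0
  else if [&& (2 <= size K)%N, (k1 <= a.-1)%N & (a + b <= k2)%N] then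
    (k2%:R - a%:R - b%:R) + (k2%:R - k1%:R) / (k2%:R - 1)
  else (ThetaK K (a + b))%:R.

Definition e_positive (N n : nat) (f : {mpoly rat[N]}) : Prop :=
  exists d : seq nat -> rat, (forall la, 0 <= d la) /\
    f = sum_comp n (fun la => if sorted geq la then d la *: eK N la else 0).
Arguments e_positive : clear implicits.

(* Main.v *)
(* For a rooted graph let g i be the sum over proper colourings with root colour i.
   Attaching a pendant edge at the root, and moving the root to its new end, turns g into
   ext g i = x_i (sum_j g j - g i); gluing K_(a+1) at the root gives
   a! sum_i g i e_a(x without x_i), and e_(a+1)(x without x_i) = e_(a+1) - x_i e_a(x without x_i)
   yields
     Phi_a g = |ext^a g| - sum_(1 <= j <= a) (j - 1) e_j |ext^(a - j) g|,
   where a! Phi_a g is that glued sum and |g| = sum_i g i.  Paths are iterates of ext on x, and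
   Phi_n x = (n + 1) e_(n + 1), so this recursion gives P_n = sum_K w_K e_K.  Breaking the
   closing edge of a cycle gives, for a cycle C_c with a tail of m edges,
     T_(m, c+1) = T_(m+1, c) + P_(m+c+1) - P_(m+1) T_(0, c),
   which is solved by sum_K Theta_K(m+1) w_K e_K because Theta_K(t) - Theta_K(t+1) is 1, minus
   the part of K starting at t when t is a partial sum of K.  Inserting j as second part of K in
   the recursion for Phi cancels the compositions with k_2 < a, up to terms with k_1 >= a + b,
   which are moved to the compositions with k_1 and k_2 exchanged. *)
Require Import Defs.
From HB Require Import structures.
From mathcomp Require Import all_boot all_order all_algebra.
From mathcomp Require Import mpoly.
From mathcomp Require Import zify ring.
Import Order.TTheory GRing.Theory Num.Theory.
Local Open Scope ring_scope.
Set Implicit Arguments. Unset Strict Implicit. Unset Printing Implicit Defensive.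

Lemma big_tupleS (V : nmodType) (T : finType) n (F : seq T -> V) :
  \sum_(t : n.+1.-tuple T) F t = \sum_(i : T) \sum_(t : n.-tuple T) F (i :: t).
Proof.
rewrite pair_big (reindex (fun p : T * n.-tuple T => [tuple of p.1 :: p.2])) //=.
exists (fun t => (thead t, [tuple of behead t])) => [[i t] _ | t _] /=.
  by congr pair; apply/val_inj.
by rewrite [RHS]tuple_eta; apply/val_inj.
Qed.

(** * Colour sums of rooted graphs *)

Section ElementarySymmetric.
Variables (R : comNzRingType) (I : finType) (x : I -> R).

Definition esym_avoid (D : {set I}) k : R :=
  \sum_(h : {set I} | (#|h| == k) && [disjoint h & D]) \prod_(i in h) x i.

Lemma esym_avoid0 D : esym_avoid D 0 = 1.
Proof.
rewrite /esym_avoid (big_pred1 set0) ?big_set0 // => h.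
rewrite cards_eq0 /=; case: eqP => // ->; by rewrite -setI_eq0 set0I eqxx.
Qed.

Lemma disjointU1r (h D : {set I}) i :
  [disjoint h & i |: D] = (i \notin h) && [disjoint h & D].
Proof.
by rewrite disjoint_sym disjoints_subset subUset sub1set inE -disjoints_subset disjoint_sym.
Qed.

(** Adding [i] is a bijection from the [k]-sets avoiding [i] and [D] onto the [k.+1]-sets through
    [i] avoiding [D]. *)
Lemma esym_avoid_mulr (D : {set I}) i k : i \notin D ->
  x i * esym_avoid (i |: D) k =
  \sum_(h : {set I} | [&& #|h| == k.+1, [disjoint h & D] & i \in h]) \prod_(j in h) x j.
Proof.
move=> iD; rewrite /esym_avoid big_distrr /=.
rewrite [RHS](reindex_onto (fun h => i |: h) (fun h => h :\ i)) /=; last first.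
  by move=> h /and3P[_ _ ih]; rewrite setD1K.
apply: eq_big => [h|h /andP[_]]; last first.
  by rewrite disjointU1r => /andP[ih _]; rewrite big_setU1.
rewrite disjointU1r setU11 andbT (disjoint_sym (i |: h)) disjointU1r iD /= (disjoint_sym D).
case ih: (i \in h) => /=.
  by rewrite andbF; apply/esym/negP => /andP[_ /eqP e]; move: ih; rewrite -e !inE eqxx.
by rewrite cardsU1 ih setU1K ?ih // eqxx andbT eqSS.
Qed.

Lemma esym_avoidS (D : {set I}) i k : i \notin D ->
  esym_avoid D k.+1 = esym_avoid (i |: D) k.+1 + x i * esym_avoid (i |: D) k.
Proof.
move=> iD; rewrite esym_avoid_mulr // {1}/esym_avoid (bigID (fun h : {set I} => i \in h)) /= addrC.
congr (_ + _); apply: eq_bigl => h; rewrite ?disjointU1r -?andbA //.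
by congr andb; rewrite andbC.
Qed.

(** Double counting: each set of size [k.+1] avoiding [D] arises once from each of its elements. *)
Lemma sum_esym_avoid D k :
  \sum_(i in ~: D) x i * esym_avoid (i |: D) k = esym_avoid D k.+1 *+ k.+1.
Proof.
pose G i := \sum_(h : {set I} | [&& #|h| == k.+1, [disjoint h & D] & i \in h]) \prod_(j in h) x j.
rewrite (eq_bigr G) => [|i]; last by rewrite inE => iD; apply: esym_avoid_mulr.
rewrite (exchange_big_dep (fun h : {set I} => (#|h| == k.+1) && [disjoint h & D])) /=; last first.
  by move=> i h _ /and3P[-> ->].
rewrite /esym_avoid -sumrMnl; apply: eq_bigr => h /andP[/eqP hk hD].
rewrite (eq_bigl (mem h)) => [|i]; last first.
  rewrite hk hD eqxx inE /=; case ih: (i \in h); rewrite ?andbF // andbT.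
  by rewrite (disjointFr hD ih).
by rewrite sumr_const hk.
Qed.

End ElementarySymmetric.

(** * Weighted sums over words of colours *)

Section Words.
Variables (R : comNzRingType) (I : finType) (x : I -> R).

(** A word lists the colours of the vertices in order. [F] takes plain lists, so that words can be
    cut and concatenated freely. *)
Definition wsum n (F : seq I -> R) : R :=
  \sum_(t : n.-tuple I) (\prod_(i <- t) x i) * F t.

Lemma eq_wsum n F G : (forall s, size s = n -> F s = G s) -> wsum n F = wsum n G.
Proof. by move=> FG; apply: eq_bigr => t _; rewrite FG ?size_tuple. Qed.

Lemma wsum0 F : wsum 0 F = F [::].
Proof.
rewrite /wsum (big_pred1 [tuple]) => [|t]; last by rewrite [t]tuple0 [RHS]eqxx.
by rewrite big_nil mul1r.
Qed.

Lemma wsumS n F : wsum n.+1 F = \sum_i x i * wsum n (fun s => F (i :: s)).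
Proof.
rewrite /wsum (big_tupleS n (fun s => (\prod_(i <- s) x i) * F s)).
apply: eq_bigr => i _; rewrite big_distrr; apply: eq_bigr => t _.
by rewrite /= big_cons mulrA.
Qed.

Lemma wsum_cat m n F : wsum (m + n) F = wsum m (fun s => wsum n (fun t => F (s ++ t))).
Proof.
elim: m F => [|m IH] F; first by rewrite wsum0.
by rewrite addSn !wsumS; apply: eq_bigr => i _; rewrite IH.
Qed.

Lemma wsumMl n r F : wsum n (fun s => r * F s) = r * wsum n F.
Proof. by rewrite /wsum big_distrr /=; apply: eq_bigr => t _; rewrite mulrCA. Qed.

Lemma wsumMr n r F : wsum n (fun s => F s * r) = wsum n F * r.
Proof. by rewrite mulrC -wsumMl; apply: eq_wsum => s _; rewrite mulrC. Qed.

Lemma wsumB n F G : wsum n (fun s => F s - G s) = wsum n F - wsum n G.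
Proof. by rewrite /wsum -sumrB; apply: eq_bigr => t _; rewrite mulrBr. Qed.

Lemma wsum_sum n (F : I -> seq I -> R) :
  wsum n (fun s => \sum_i F i s) = \sum_i wsum n (F i).
Proof. by rewrite /wsum exchange_big; apply: eq_bigr => t _; rewrite big_distrr. Qed.

(** These words are the proper colourings of a [k]-clique by colours outside [D]; each set of [k]
    colours has k! orderings. *)
Lemma wsum_uniq (D : {set I}) k :
  wsum k (fun s => (uniq s && all (fun i => i \notin D) s)%:R) =
  esym_avoid x D k *+ k`!.
Proof.
elim: k D => [|k IH] D; first by rewrite wsum0 esym_avoid0.
rewrite wsumS factS mulrnA -sum_esym_avoid -sumrMnl.
rewrite [RHS]big_mkcond; apply: eq_bigr => i _; rewrite inE /=.
case: ifPn => iD; last first.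
  rewrite (_ : wsum _ _ = 0) ?mulr0 // -[RHS](mul0r (wsum k (fun=> 0))) -wsumMl.
  by apply: eq_wsum => s _; rewrite andbF mul0r.
rewrite -mulrnAr -IH; congr (_ * _); apply: eq_wsum => s _; congr (nat_of_bool _)%:R.
rewrite -andbA andbCA; congr andb.
rewrite -has_pred1 -all_predC -all_predI; apply: eq_all => j /=.
by rewrite !inE negb_or; congr andb; rewrite eq_sym.
Qed.

(** * Paths, cycles and cliques attached at a root *)

Definition ext (g : I -> R) (i : I) : R := x i * (\sum_j g j - g i).

Lemma eq_ext f g : f =1 g -> ext f =1 ext g.
Proof. by move=> fg i; rewrite /ext fg (eq_bigr g). Qed.

Lemma eq_iter_ext m f g : f =1 g -> iter m ext f =1 iter m ext g.
Proof. by move=> fg; elim: m => //= m IH; apply: eq_ext. Qed.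

Lemma iter_extD m f g :
  iter m ext (fun i => f i + g i) =1 (fun i => iter m ext f i + iter m ext g i).
Proof.
elim: m => //= m IH i; rewrite (eq_ext IH) /ext big_split /=; ring.
Qed.

Lemma iter_extM m r g :
  iter m ext (fun i => g i * r) =1 (fun i => iter m ext g i * r).
Proof.
elim: m => //= m IH i; rewrite (eq_ext IH) /ext -big_distrl /=; ring.
Qed.

Definition neq : rel I := fun i j => i != j.

(** The word runs from the final root, of colour [i], back to the vertex carrying [h]; each letter
    read undoes one [ext]. *)
Lemma wsum_path m h i :
  x i * wsum m (fun t => (path neq i t)%:R * h (last i t)) =
  iter m ext (fun j => x j * h j) i.
Proof.
elim: m i => [|m IH] i; first by rewrite wsum0 mul1r.
rewrite wsumS iterS /ext; congr (_ * _).
rewrite [in RHS](bigD1 i) //= addrAC subrr add0r [LHS](bigD1 i) //=.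
rewrite [X in X + _](_ : _ = 0) ?add0r.
  apply: eq_bigr => j ji; rewrite -IH; congr (_ * _); apply: eq_wsum => s _ /=.
  by rewrite {1}/neq eq_sym ji.
rewrite (eq_wsum (G := fun=> 0 * 0)) ?wsumMl ?mul0r ?mulr0 // => s _.
by rewrite /= {1}/neq eqxx mul0r.
Qed.

(* [cycle_rooted k] is the rooted function of the cycle on [k.+1] vertices. *)
Definition cycle_rooted k (i : I) : R :=
  x i * wsum k (fun t => (path neq i t)%:R * (i != last i t)%:R).

Lemma cycle_rooted0 i : cycle_rooted 0 i = 0.
Proof. by rewrite /cycle_rooted wsum0 /= eqxx !mulr0. Qed.

(** Break the closing edge: colourings of the cycle are those of a path minus those whose ends
    agree. Identifying equal ends leaves the cycle with one vertex fewer and a factor [x i], and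
    [x i * g i] is [x i * \sum_j g j - ext g i]. *)
Lemma cycle_rootedS k i :
  cycle_rooted k.+1 i =
  iter k.+1 ext x i + ext (cycle_rooted k) i - x i * \sum_j cycle_rooted k j.
Proof.
have -> : iter k.+1 ext x i = x i * wsum k.+1 (fun t => (path neq i t)%:R).
  rewrite (eq_iter_ext _ (g := fun j => x j * 1)) => [|j]; last by rewrite mulr1.
  rewrite -(wsum_path _ (fun=> 1)); congr (_ * _); apply: eq_wsum => s _.
  by rewrite mulr1.
suff e : wsum k.+1 (fun t => (path neq i t)%:R * (i == last i t)%:R) = cycle_rooted k i.
  rewrite /ext -e {1}/cycle_rooted mulrBr addrA addrAC addrK -mulrBr -wsumB.
  congr (_ * _); apply: eq_wsum => s _; case: (i == _); rewrite ?mulr1 ?mulr0 ?subrr ?subr0 //.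
rewrite -addn1 wsum_cat /cycle_rooted -wsumMl; apply: eq_wsum => s _.
rewrite wsumS (bigD1 i) //= wsum0 last_cat /= eqxx mulr1 cat_path /= andbT.
rewrite big1 ?addr0 => [|j ji]; last first.
  by rewrite wsum0 last_cat /= eq_sym (negbTE ji) !mulr0.
by rewrite -mulnb natrM /neq eq_sym.
Qed.

(** The tail has [m] edges and the cycle [k.+1] vertices. For [k = 0] the cycle is a loop, without
    proper colourings. *)
Definition tadpole m k : R := \sum_i iter m ext (cycle_rooted k) i.
Definition path_sum m : R := \sum_i iter m ext x i.

Lemma tadpole0 m : tadpole m 0 = 0.
Proof.
rewrite /tadpole big1 // => i _.
by rewrite (eq_iter_ext _ (g := fun i => x i * 0)) ?iter_extM => [|j]; rewrite ?cycle_rooted0 mulr0.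
Qed.

Lemma tadpoleS m k :
  tadpole m k.+1 = path_sum (m + k.+1) + tadpole m.+1 k - path_sum m * tadpole 0 k.
Proof.
rewrite /tadpole /path_sum -big_split /= big_distrl /= -sumrB; apply: eq_bigr => i _.
pose C := \sum_j cycle_rooted k j.
rewrite (eq_iter_ext _ (g := fun i => (iter k.+1 ext x i + ext (cycle_rooted k) i) + x i * (- C))); last first.
  by move=> j; rewrite cycle_rootedS mulrN.
rewrite !iter_extD iter_extM mulrN; congr (_ + _ - _); first by rewrite iterD.
by rewrite -iterSr.
Qed.

Definition clique_sum a (g : I -> R) : R := \sum_i g i * esym_avoid x [set i] a.

Lemma clique_sumS a g :
  clique_sum a.+1 g =
  clique_sum a (ext g) - a%:R * esym_avoid x set0 a.+1 * \sum_i g i.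
Proof.
pose E := esym_avoid x set0 a.+1.
have e1 i : x i * esym_avoid x [set i] a = E - esym_avoid x [set i] a.+1.
  by rewrite /E (esym_avoidS x (i := i)) ?inE // setU0 addrC addKr.
have e2 : \sum_i x i * esym_avoid x [set i] a = a.+1%:R * E.
  rewrite mulr_natl -sum_esym_avoid; apply: eq_big => i; first by rewrite !inE.
  by rewrite setU0.
have e3 : \sum_i g i * (E - esym_avoid x [set i] a.+1) = (\sum_i g i) * E - clique_sum a.+1 g.
  by rewrite mulr_suml -sumrB; apply: eq_bigr => i _; rewrite mulrBr.
have -> : clique_sum a (ext g) = a.+1%:R * E * \sum_i g i - \sum_i g i * (E - esym_avoid x [set i] a.+1).
  rewrite -e2 mulrC mulr_sumr -sumrB; apply: eq_bigr => i _.
  by rewrite -e1 /ext; ring.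
rewrite e3 -/E -natr1; ring.
Qed.

Lemma clique_sum_ext a g :
  clique_sum a g = \sum_i iter a ext g i -
    \sum_(1 <= j < a.+1) (j.-1)%:R * esym_avoid x set0 j * \sum_i iter (a - j) ext g i.
Proof.
elim: a g => [|a IH] g.
  rewrite big_geq // subr0; apply: eq_bigr => i _; by rewrite esym_avoid0 mulr1.
rewrite clique_sumS IH [in RHS]big_nat_recr //= subnn opprD addrA -iterS iterSr.
congr (_ - _ - _); apply: eq_big_nat => j /andP[_ ja].
by rewrite -iterSr subSn.
Qed.

(** The clique recursion at [g = x], where the glued graph is the clique itself. *)
Lemma path_sum_rec n :
  path_sum n = n.+1%:R * esym_avoid x set0 n.+1 +
    \sum_(1 <= j < n.+1) (j.-1)%:R * esym_avoid x set0 j * path_sum (n - j).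
Proof.
apply/eqP; rewrite -subr_eq; apply/eqP; rewrite -clique_sum_ext mulr_natl -sum_esym_avoid.
by apply: eq_big => i; rewrite ?inE // setU0.
Qed.

End Words.

(** * Compositions *)

(** A duplicate-free list with the same enumeration as [sum_comp], so that sums can be reindexed by
    comparing members. *)
Definition comps n : seq (seq nat) :=
  [seq K <- allpairs_dep (fun l (t : l.-tuple 'I_n.+1) => [seq val i | i <- t])
     (iota 0 n.+1) (fun l => enum {: l.-tuple 'I_n.+1})
     | is_composition n K].

Lemma mem_comps n K : (K \in comps n) = is_composition n K.
Proof.
rewrite mem_filter; case KP: (is_composition n K) => //; rewrite andTb.
have /andP[pos /eqP sK] := KP.
have szK : (size K <= n)%N.
  rewrite -sK; elim: {KP sK} K pos => //= k K IH /andP[k0 /IH]; lia.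
have le_n k : k \in K -> (k < n.+1)%N.
  rewrite ltnS -sK; elim: {KP sK pos szK} K => //= j K IH; rewrite inE => /orP[/eqP->|/IH]; lia.
apply/allpairsPdep; exists (size K).
exists [tuple of [seq (inord k : 'I_n.+1) | k <- in_tuple K]].
rewrite mem_iota mem_enum; split => //=.
rewrite -map_comp map_id_in // => k /le_n kn /=.
by rewrite inordK.
Qed.

Lemma comps_uniq n : uniq (comps n).
Proof.
apply/filter_uniq/allpairs_uniq_dep => [|l _|[l t] [l' t'] _ _ /= e].
- exact: iota_uniq.
- exact: enum_uniq.
have ll' : l = l' by rewrite -(size_tuple t) -(size_map val) e size_map size_tuple.
by case: l' / ll' t' e => t' /(inj_map val_inj)/val_inj ->.
Qed.

Lemma sum_compE N n F : @sum_comp N n F = \sum_(K <- comps n) F K.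
Proof.
rewrite big_filter big_mkcond big_allpairs_dep /sum_comp.
rewrite -[in LHS](big_mkord xpredT (fun l =>
  \sum_(t : l.-tuple 'I_n.+1 | is_composition n [seq val i | i <- t]) F [seq val i | i <- t])).
rewrite /index_iota subn0; apply: eq_bigr => l _.
by rewrite big_enum -big_mkcond.
Qed.

Lemma sum_compsS (V : nmodType) n (F : seq nat -> V) : (0 < n)%N ->
  \sum_(K <- comps n) F K =
  \sum_(1 <= k < n.+1) \sum_(K <- comps (n - k)) F (k :: K).
Proof.
move=> n0; rewrite /index_iota subn1 /= -big_allpairs_dep; apply/perm_big/uniq_perm.
- exact: comps_uniq.
- apply: allpairs_uniq_dep => [|k _|[k K] [k' K'] _ _ /= [-> ->] //].
    exact: iota_uniq.
  exact: comps_uniq.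
move=> K; rewrite mem_comps; apply/idP/allpairsPdep => [|[k [K' [kn]]]].
  case: K => [|k K]; rewrite /is_composition /= ?(ltn_eqF n0) //.
  move=> /andP[/andP[k0 pK] /eqP sK]; exists k, K; rewrite mem_iota mem_comps /is_composition pK.
  by split => //; [lia | apply/eqP; lia].
rewrite mem_iota mem_comps in kn *; move=> /andP[pK /eqP sK] ->.
by rewrite /is_composition /= pK andbT; apply/andP; split; lia.
Qed.

Lemma comps0 : comps 0 = [:: [::]].
Proof.
have := comps_uniq 0; have := mem_comps 0.
case: (comps 0) => [/(_ [::]) //|K s h].
have h0 K' : is_composition 0 K' -> K' = [::] by case: K' => //= k K'; rewrite /is_composition /=; lia.
have K0 : K = [::] by apply: h0; rewrite -h mem_head.
case: s h => [|K' s] h; first by rewrite K0.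
have K'0 : K' = [::] by apply: h0; rewrite -h !inE eqxx orbT.
by rewrite K0 K'0 cons_uniq mem_head.
Qed.

(** * Theta and the partial sums of a composition *)

Lemma sigmaK_nat K t : sigmaK K t =
  \big[minn/sumn K]_(0 <= j < (size K).+1 | (t <= sumn (take j K))%N) sumn (take j K).
Proof. by rewrite big_mkord. Qed.

(** For positive [t] the empty partial sum is excluded; all others, and the default value, contain
    [k], which comes out of the minimum. *)
Lemma sigmaK_cons k K t : (0 < t)%N -> sigmaK (k :: K) t = (k + sigmaK K (t - k))%N.
Proof.
move=> t0; rewrite !sigmaK_nat big_ltn_cond //= leqNgt t0 /= big_add1 /=.
rewrite (big_morph (addn k) (id1 := (k + sumn K)%N) (op1 := minn)) //; last first.
  by move=> i j; rewrite addn_minr.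
by apply: eq_bigl => j; rewrite leq_subLR.
Qed.

Lemma sigmaK0 K : sigmaK K 0 = 0%N.
Proof. by rewrite sigmaK_nat big_ltn_cond //= take0 min0n. Qed.

Lemma ThetaK0 K : ThetaK K 0 = 0%N.
Proof. by rewrite /ThetaK sigmaK0. Qed.

Lemma ThetaK_cons k K t : (0 < t)%N ->
  ThetaK (k :: K) t = if (t <= k)%N then (k - t)%N else ThetaK K (t - k).
Proof.
move=> t0; rewrite /ThetaK sigmaK_cons //; case: leqP => [tk|kt].
  by have/eqP-> : (t - k == 0)%N; rewrite // sigmaK0 addn0.
by rewrite subnBA 1?ltnW // addnC.
Qed.

Lemma ThetaK_sumn K : ThetaK K (sumn K) = 0%N.
Proof.
elim: K => [|k K IH]; first by rewrite ThetaK0.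
case: (posnP (sumn (k :: K))) => [->|s0]; first by rewrite ThetaK0.
rewrite ThetaK_cons //=; case: ifP => [|_]; first by lia.
by rewrite addKn.
Qed.

(* The part of [K] that starts at the partial sum [t]; 0 when there is none. *)
Fixpoint next_part (K : seq nat) (t : nat) : nat :=
  if K is k :: K' then
    if t == 0%N then k else if (k <= t)%N then next_part K' (t - k)%N else 0%N
  else 0%N.

(** If [t] is not a partial sum, sigma is unchanged and Theta drops by 1; if it is, Theta vanishes
    at [t] and sigma then jumps by the part starting there. *)
Lemma ThetaK_next K t : all (fun k => 0 < k)%N K -> (t < sumn K)%N ->
  (ThetaK K t + next_part K t = (ThetaK K t.+1).+1)%N.
Proof.
elim: K t => //= k K IH t /andP[k0 pK] tK; rewrite (ThetaK_cons k K (ltn0Sn t)).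
case: (posnP t) => [->|t0]; first by rewrite ThetaK0 k0; lia.
rewrite ThetaK_cons //; case: (leqP k t) => kt; last by rewrite ltnW //; lia.
rewrite subSn // -IH //; last by lia.
case: ltngtP kt => // <-; rewrite subnn; by rewrite ThetaK0; lia.
Qed.

(** * Path and tadpole expansions *)

Section PathAndTadpole.
Variables (R : comNzRingType) (E : nat -> R).

(** Both sides run over the pairs of positive [i], [j] with [i + j <= n]. *)
Lemma sum_triangle_exchange (V : nmodType) n (F : nat -> nat -> V) :
  \sum_(1 <= i < n) \sum_(1 <= j < (n - i).+1) F i j =
  \sum_(1 <= j < n) \sum_(1 <= i < (n - j).+1) F i j.
Proof.
have widen G : \sum_(1 <= i < n) \sum_(1 <= j < (n - i).+1) G i j =
    \sum_(1 <= i < n) \sum_(1 <= j < n | (i + j <= n)%N) G i j :> V.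
  apply: eq_big_nat => i /andP[i0 ilt].
  rewrite (big_nat_widen _ _ n) /=; last by lia.
  by apply: eq_bigl => j; lia.
rewrite !widen (exchange_big_dep xpredT) //=; apply: eq_bigr => i _.
by apply: eq_bigl => j; rewrite addnC.
Qed.

(** The share of parts after the first in w_K e_K: every part [k], including the head of [K],
    contributes [k.-1]. *)
Definition tail_weight (K : seq nat) : R := \prod_(k <- K) ((k.-1)%:R * E k).
Definition comp_weight (K : seq nat) : R := (wK K)%:R * \prod_(k <- K) E k.

Lemma tail_weight_cons k K : tail_weight (k :: K) = (k.-1)%:R * E k * tail_weight K.
Proof. by rewrite /tail_weight big_cons. Qed.

Lemma comp_weight_cons k K : comp_weight (k :: K) = k%:R * E k * tail_weight K.
Proof.
rewrite /comp_weight /tail_weight big_cons /= big_split /= natrM natr_prod.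
under [in RHS]eq_bigr do rewrite -subn1.
ring.
Qed.

Definition tail_sum n := \sum_(K <- comps n) tail_weight K.
Definition comp_sum n := \sum_(K <- comps n) comp_weight K.
Definition head_sum n := \sum_(K <- comps n) (head 0%N K)%:R * tail_weight K.

Lemma tail_sum0 : tail_sum 0 = 1.
Proof. by rewrite /tail_sum comps0 big_seq1 /tail_weight big_nil. Qed.

Lemma tail_sum_rec n : (0 < n)%N ->
  tail_sum n = \sum_(1 <= k < n.+1) (k.-1)%:R * E k * tail_sum (n - k).
Proof.
move=> n0; rewrite /tail_sum sum_compsS //; apply: eq_bigr => k _.
by rewrite big_distrr /=; apply: eq_bigr => K _; rewrite tail_weight_cons.
Qed.

Lemma comp_sum_head n : (0 < n)%N ->
  comp_sum n = \sum_(1 <= k < n.+1) k%:R * E k * tail_sum (n - k).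
Proof.
move=> n0; rewrite /comp_sum sum_compsS //; apply: eq_bigr => k _.
by rewrite big_distrr /=; apply: eq_bigr => K _; rewrite comp_weight_cons.
Qed.

(** Here the second part [j] is split off, not the first: what remains is again a composition
    weighted by [comp_weight]. *)
Lemma comp_sum_rec n :
  comp_sum n.+1 = n.+1%:R * E n.+1 +
    \sum_(1 <= j < n.+1) (j.-1)%:R * E j * comp_sum (n.+1 - j).
Proof.
rewrite comp_sum_head // big_nat_recr //= subnn tail_sum0 mulr1 addrC; congr (_ + _).
transitivity (\sum_(1 <= k < n.+1) \sum_(1 <= j < (n.+1 - k).+1)
    k%:R * E k * ((j.-1)%:R * E j * tail_sum (n.+1 - k - j))).
  by apply: eq_big_nat => k /andP[_ kn]; rewrite tail_sum_rec ?subn_gt0 // big_distrr.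
rewrite sum_triangle_exchange; apply: eq_big_nat => j /andP[_ jn].
rewrite comp_sum_head ?subn_gt0 // big_distrr; apply: eq_bigr => k _ /=.
by rewrite mulrCA subnAC.
Qed.

Lemma next_part_cons k K t : (0 < t)%N ->
  next_part (k :: K) t = if (k <= t)%N then next_part K (t - k) else 0%N.
Proof. by case: t. Qed.

Arguments next_part : simpl never.

(** Splitting off the first part, for both weights at once. A first part exceeding [m] jumps over
    [m] and contributes nothing. *)
Lemma sum_next_part_cons (F G : seq nat -> R) (u : nat -> R) m n :
  (forall k K, F (k :: K) = u k * G K) -> (0 < m)%N ->
  \sum_(K <- comps (m + n)) (next_part K m)%:R * F K =
  \sum_(1 <= k < m.+1) u k * \sum_(K <- comps (m - k + n)) (next_part K (m - k))%:R * G K.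
Proof.
move=> FG m0; rewrite sum_compsS ?addn_gt0 ?m0 //.
rewrite (big_cat_nat (n := m.+1)) ?ltnS ?leq_addr //= [X in _ + X]big1_seq ?addr0.
  apply: eq_big_nat => k /andP[_ km]; rewrite -addnBAC // big_distrr.
  by apply: eq_bigr => K _; rewrite next_part_cons // -ltnS km FG mulrCA.
move=> k; rewrite mem_index_iota => /andP[_ /andP[mk _]].
by rewrite big1 // => K _; rewrite next_part_cons // leqNgt mk mul0r.
Qed.

(** Only compositions with partial sum [m] count; they split there into compositions of [m] and [n],
    and [next_part] is the head of the second. *)
Lemma sum_next_part_tail m n : (0 < n)%N ->
  \sum_(K <- comps (m + n)) (next_part K m)%:R * tail_weight K =
  tail_sum m * head_sum n.
Proof.
move=> n0; have [N] := ubnP m; elim: N m => // N IH m mN.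
case: (posnP m) => [->|m0].
  by rewrite tail_sum0 mul1r; apply: eq_bigr => -[|k K].
rewrite (sum_next_part_cons _ tail_weight_cons) // tail_sum_rec // big_distrl.
apply: eq_big_nat => k /andP[k0 km] /=; rewrite IH ?mulrA //; lia.
Qed.

Lemma sum_next_part m n : (0 < m)%N -> (0 < n)%N ->
  \sum_(K <- comps (m + n)) (next_part K m)%:R * comp_weight K =
  comp_sum m * head_sum n.
Proof.
move=> m0 n0.
rewrite (sum_next_part_cons _ comp_weight_cons) // comp_sum_head // big_distrl.
by apply: eq_bigr => k _; rewrite sum_next_part_tail //= mulrA.
Qed.

(** The conjectural value of [tadpole m k]: that graph has [m + k + 1] vertices, and the threshold
    is [m.+1]. *)
Definition theta_sum m k : R :=
  \sum_(K <- comps (m + k).+1) (ThetaK K m.+1)%:R * comp_weight K.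

Lemma theta_sum0 m : theta_sum m 0 = 0.
Proof.
rewrite /theta_sum big1_seq // => K /andP[_]; rewrite addn0 mem_comps => /andP[_ /eqP <-].
by rewrite ThetaK_sumn mul0r.
Qed.

(** With first part [j], Theta at 1 is [j.-1]; both sides carry the factor [j * j.-1], divided
    differently between coefficient and weight. *)
Lemma head_sumE k : head_sum k.+1 = theta_sum 0 k.
Proof.
rewrite /head_sum /theta_sum !sum_compsS //; apply: eq_big_nat => j /andP[j0 _].
apply: eq_bigr => K _; rewrite ThetaK_cons // j0 subn1 comp_weight_cons tail_weight_cons /=; ring.
Qed.

Lemma theta_sumS m k :
  theta_sum m k.+1 = comp_sum (m + k.+1).+1 + theta_sum m.+1 k
                     - comp_sum m.+1 * theta_sum 0 k.
Proof.
rewrite -head_sumE -sum_next_part // /theta_sum /comp_sum !addSn !addnS -big_split /= -sumrB.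
apply: eq_big_seq => K; rewrite mem_comps => /andP[pK /eqP sK] /=.
apply/eqP; rewrite eq_sym subr_eq -mulrDl -natrD ThetaK_next ?sK //; last by lia.
by rewrite -natr1 mulrDl mul1r addrC.
Qed.

Variables (I : finType) (x : I -> R).
Hypothesis E_esym : forall k, esym_avoid x set0 k = E k.

Lemma path_sumE n : path_sum x n = comp_sum n.+1.
Proof.
have [N] := ubnP n; elim: N n => // N IH n nN.
rewrite path_sum_rec comp_sum_rec E_esym; congr (_ + _).
apply: eq_big_nat => j /andP[j0 jn]; rewrite E_esym IH; last by lia.
by rewrite subSn.
Qed.

(** Both sides satisfy the same recursion in [k] and vanish at [k = 0]. *)
Lemma tadpoleE m k : tadpole x m k = theta_sum m k.
Proof.
elim: k m => [|k IH] m; first by rewrite tadpole0 theta_sum0.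
by rewrite tadpoleS theta_sumS !path_sumE !IH.
Qed.

End PathAndTadpole.

(** * Colourings as words *)

Section Graph.
Variables (R : comNzRingType) (I : finType) (x : I -> R).

(** [insub] turns the list back into a tuple; all words in the sum have length [n], so the default 0
    is never reached. *)
Lemma sum_ffun_words n (P : pred {ffun 'I_n -> I}) :
  \sum_(k : {ffun 'I_n -> I} | P k) \prod_(v : 'I_n) x (k v) =
  wsum x n (fun s => if insub s is Some t then (P [ffun i => tnth (t : n.-tuple I) i])%:R else 0).
Proof.
rewrite /wsum (reindex (fun t : n.-tuple I => [ffun i => tnth t i])) /=.
  rewrite big_mkcond; apply: eq_bigr => t _; rewrite valK.
  case: (P _); rewrite ?mulr0 // mulr1 big_tuple.
  by apply: eq_bigr => i _; rewrite ffunE.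
exists (fun k : {ffun 'I_n -> I} => [tuple k i | i < n]) => [t _|k _].
  by apply: eq_from_tnth => i; rewrite tnth_mktuple ffunE.
by apply/ffunP => i; rewrite ffunE tnth_mktuple.
Qed.

Lemma proper_cpc a b c N (k : {ffun 'I_(a + b + c - 1) -> 'I_N}) (f : nat -> 'I_N) :
  (forall i, f (val i) = k i) ->
  proper_coloring (cpc_adj a b c) k <->
  forall i j, (i < a + b + c - 1)%N -> (j < a + b + c - 1)%N -> i != j ->
    cpc_edge a b c i j -> f i != f j.
Proof.
move=> fk; split=> [/forallP kP i j iN jN ij e|fP].
  have /forallP/(_ (Ordinal jN)) := kP (Ordinal iN).
  by rewrite -!fk /= /cpc_adj -val_eqE /= ij e.
apply/forallP => u; apply/forallP => v; apply/implyP; rewrite /cpc_adj -val_eqE -!fk.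
move=> /andP[uv /orP[]]; first exact: fP.
by rewrite eq_sym; apply: fP; rewrite // eq_sym.
Qed.

(** The word lists the other clique vertices [u], the clique root [r], the path [t1] and the rest
    [t2] of the cycle. The cycle root has colour [last r t1], which is [r] when [b = 0]. *)
Lemma proper_cpc_word a b c N (k : {ffun 'I_(a.+1 + b + c.+2 - 1) -> 'I_N}) u r t1 t2 :
  size u = a -> size t1 = b -> size t2 = c.+1 ->
  (forall i, nth r (u ++ r :: t1 ++ t2) (val i) = k i) ->
  proper_coloring (cpc_adj a.+1 b c.+2) k =
  (uniq u && (r \notin u)) &&
  (path (@neq _) r t1 &&
    (path (@neq _) (last r t1) t2 && (last r t1 != last (last r t1) t2))).
Proof.
move=> su s1 s2 /proper_cpc H.
set s := u ++ r :: t1 ++ t2 in H; pose f := nth r s.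
have ss : size s = (a.+1 + b + c.+2 - 1)%N by rewrite size_cat /= size_cat; lia.
(* The root at position [a] belongs to both readings of the word: as the end of [rcons u r] and as
   the start of [r :: t1 ++ t2]. *)
have fl i : (i <= a)%N -> f i = nth r (rcons u r) i.
  move=> ia; rewrite /f /s -cat_rcons nth_cat size_rcons su ltnS ia //.
have fr i : f (a + i)%N = nth r (r :: t1 ++ t2) i.
  by rewrite /f /s nth_cat su ltnNge leq_addr /= addKn.
have fm : f (a + b)%N = last r t1.
  by rewrite fr (last_nth r) s1 -cat_cons nth_cat /= s1 ltnS leqnn.
have fe : f (a + b + c.+1)%N = last (last r t1) t2.
  by rewrite -addnA fr -last_cat (last_nth r) size_cat s1 s2.
have -> : (uniq u && (r \notin u)) = uniq (rcons u r) by rewrite rcons_uniq andbC.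
rewrite [path _ r t1 && _]andbA -cat_path -fe -fm.
apply/idP/idP => [/H {H} fP|].
  apply/and3P; split.
  - apply/(uniqP r) => i j; rewrite !inE size_rcons su !ltnS => ia ja.
    rewrite -!fl // => /eqP fij; apply/eqP/negPn/negP => ij; move: fij; apply/negP.
    apply: fP => //; rewrite /cpc_edge; lia.
  - apply/(pathP r) => i; rewrite size_cat s1 s2 => ib.
    rewrite /neq -fr -[nth r (t1 ++ t2) i]/(nth r (r :: t1 ++ t2) i.+1) -fr.
    apply: fP; rewrite /cpc_edge; lia.
  - by apply: fP; rewrite /cpc_edge; lia.
case/and3P => /(uniqP r) fu /(pathP r) fp fc; apply/H => i j iN jN ij.
case/orP => [/orP[/orP[]|]|].
- move=> /and3P[ia ja _]; rewrite -/(f i) -/(f j) !fl //; apply: contraNneq ij => fij.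
  by apply/eqP/fu => //; rewrite inE size_rcons su.
(* Edges of the path, and next those of the opened cycle, join consecutive letters of
   [r :: t1 ++ t2]. *)
- move=> /and3P[/eqP -> ai ib].
  have := fp (i - a)%N; rewrite size_cat s1 s2 /neq -fr.
  rewrite -[nth r (t1 ++ t2) _]/(nth r (r :: t1 ++ t2) (i - a).+1) -fr (addnS a) subnKC; last by lia.
  by apply; lia.
- move=> /and3P[/eqP -> ai ib].
  have := fp (i - a)%N; rewrite size_cat s1 s2 /neq -fr.
  rewrite -[nth r (t1 ++ t2) _]/(nth r (r :: t1 ++ t2) (i - a).+1) -fr (addnS a) subnKC; last by lia.
  by apply; lia.
- move=> /and3P[_ /eqP -> /eqP ->].
  have -> : (a.+1 + b - 1 = a + b)%N by lia.
  have -> : (a.+1 + b + c.+2 - 2 = a + b + c.+1)%N by lia.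
  exact: fc.
Qed.

End Graph.

Lemma chrom_sym_cpc a b c N :
  chrom_sym (cpc_adj a.+1 b c.+2) N =
  clique_sum (fun i => 'X_i) a
    (iter b (ext (fun i => 'X_i)) (cycle_rooted (fun i => 'X_i) c.+1)) *+ a`!.
Proof.
rewrite /chrom_sym; pose x (i : 'I_N) : {mpoly rat[N]} := 'X_i.
rewrite (sum_ffun_words x).
have h F : wsum x (a.+1 + b + c.+2 - 1) F = wsum x (a + (b + c.+1).+1) F.
  by congr wsum; lia.
rewrite h {h} wsum_cat; set G := iter b _ _.
pose A r (u : seq 'I_N) := uniq u && (r \notin u).
transitivity (wsum x a (fun u => \sum_r (A r u)%:R * G r)).
  apply: eq_wsum => u su; rewrite wsumS; apply: eq_bigr => r _.
  (* The cycle at a root of colour [q] without the root's own factor, which [wsum_path] supplies. *)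
  pose hh q := wsum x c.+1 (fun t => (path (@neq _) q t)%:R * (q != last q t)%:R).
  rewrite /G -(wsum_path x b hh) mulrCA wsum_cat; congr (_ * _).
  rewrite -wsumMl; apply: eq_wsum => t1 s1; rewrite /hh -!wsumMl; apply: eq_wsum => t2 s2.
  have ss : size (u ++ r :: t1 ++ t2) == (a.+1 + b + c.+2 - 1)%N.
    by rewrite size_cat /= size_cat su s1 s2; apply/eqP; lia.
  rewrite insubT -!natrM !mulnb; congr (nat_of_bool _)%:R.
  apply: proper_cpc_word => // i; rewrite ffunE (tnth_nth r) //.
(* For fixed root colour [r], the words [u] are the colourings of a clique avoiding [r], counted by
   [wsum_uniq]. *)
rewrite wsum_sum /clique_sum -sumrMnl; apply: eq_bigr => r _.
rewrite wsumMr mulrC -mulrnAr -wsum_uniq; congr (_ * _); apply: eq_wsum => u _.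
congr (nat_of_bool (_ && _))%:R.
rewrite -has_pred1 -all_predC; apply: eq_all => j /=; by rewrite inE.
Qed.

(** * Attaching the clique *)

Section Assembly.
Variables (N : nat).
Local Notation E := (mesym N rat).
Local Notation Q := {mpoly rat[N]}.

Lemma esym_avoid_mesym k : esym_avoid (fun i => 'X_i : Q) set0 k = E k.
Proof. by apply: eq_bigl => h; rewrite -setI_eq0 setI0 eqxx andbT. Qed.

Lemma sum_comps_two (V : nmodType) n (F : seq nat -> V) : (0 < n)%N ->
  \sum_(K <- comps n) F K = F [:: n] +
    \sum_(1 <= i < n) \sum_(1 <= j < (n - i).+1) \sum_(K <- comps (n - i - j)) F (i :: j :: K).
Proof.
move=> n0; rewrite sum_compsS // big_nat_recr //= subnn comps0 big_seq1 addrC.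
congr (_ + _); apply: eq_big_nat => i /andP[_ ilt].
by rewrite sum_compsS // subn_gt0.
Qed.

(* On compositions starting with [i, j] the two sides of the clique recursion differ by
   [swap_defect i j - swap_defect j i], which cancels in the sum as [e_i e_j = e_j e_i]. *)
Definition swap_defect a t i j : nat := if (i < a)%N && (t <= j)%N then (i * j * i.-1)%N else 0%N.

(** For [j < a] the two Theta values agree, except that for [i >= a + b] they differ by [j], whence
    the defect. For [i < a] and [j >= a + b], the fraction in [cK] times [j - 1] is [j - i], and
    [(j - i) + j * (i - 1) = i * (j - 1)] turns [j - a - b] into Theta, [i + j - a - b]. *)
Lemma cK_two a b i j K : (0 < i)%N -> (0 < j)%N ->
  cK a b (i :: j :: K) * (i * j.-1)%:R + (swap_defect a (a + b) i j)%:R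
  + (if (j < a)%N then ThetaK (i :: K) (a + b - j) * (i * j.-1) else 0)%N%:R =
  (ThetaK (i :: j :: K) (a + b) * (i * j.-1))%:R + (swap_defect a (a + b) j i)%:R.
Proof.
move=> i0 j0; rewrite /cK /= /swap_defect; case: (ltnP j a) => ja /=.
  rewrite mul0r add0r ThetaK_cons; last by lia.
  rewrite ThetaK_cons; last by lia.
  rewrite -!natrD; congr _%:R.
  have -> : ((i < a) && (a + b <= j))%N = false by lia.
  case: (leqP (a + b) i) => hi.
    have -> : (a + b - j <= i)%N by lia.
    have -> : (i - (a + b - j) = i - (a + b) + j)%N by lia.
    by rewrite add0n mulnDl (mulnA j).
  have -> : (a + b - j <= i)%N = (a + b - i <= j)%N by lia.
  rewrite ThetaK_cons ?subn_gt0 // add0n addn0; case: ifP => hij; last by rewrite subnAC.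
  by congr (_ * _)%N; lia.
rewrite !addr0; have -> : (i <= a.-1)%N = (i < a)%N by lia.
case: ifP => [/andP[ia bj]|_]; last by rewrite [RHS]natrM mulr0n addr0.
rewrite ThetaK_cons; last by lia.
have -> : (a + b <= i)%N = false by lia.
rewrite ThetaK_cons; last by lia.
have -> : (a + b - i <= j)%N by lia.
have -> : (j - (a + b - i) = i + j - (a + b))%N by lia.
(* Here [j > i >= 1], so [j >= 2] and the denominator [j - 1] is nonzero; the substitution removes
   the predecessors. *)
have [i' ei] : {i' | i = i'.+1} by exists i.-1; lia.
have [j' ej] : {j' | j = j'.+2} by exists j.-2; lia.
subst i j; rewrite ?addr0 /= !natrM natrB; last by lia.
rewrite !natrD -!natr1 addrK; field.
by rewrite natr1 pnatr_eq0.
Qed.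

Lemma clique_combination a b n : (0 < a)%N -> (a + b < n)%N ->
  \sum_(K <- comps n) (ThetaK K (a + b))%:R * comp_weight E K -
  \sum_(1 <= j < a) (j.-1)%:R * E j * \sum_(K <- comps (n - j)) (ThetaK K (a + b - j))%:R * comp_weight E K =
  \sum_(K <- comps n) (cK a b K * (wK K)%:R) *: eK N K.
Proof.
move=> a0 abn; have n0 : (0 < n)%N by lia.
pose w2 i j K : Q := E i * E j * tail_weight E K.
have wcomp2 i j K : comp_weight E (i :: j :: K) = (i * j.-1)%:R * w2 i j K.
  by rewrite comp_weight_cons tail_weight_cons /w2 natrM; ring.
(* A composition [i :: K] of [n - j] becomes the composition [i :: j :: K] of [n]. *)
have -> : \sum_(1 <= j < a) (j.-1)%:R * E j *
      \sum_(K <- comps (n - j)) (ThetaK K (a + b - j))%:R * comp_weight E K =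
    \sum_(1 <= i < n) \sum_(1 <= j < (n - i).+1) \sum_(K <- comps (n - i - j))
      (if (j < a)%N then ThetaK (i :: K) (a + b - j) * (i * j.-1) else 0)%N%:R * w2 i j K.
  rewrite sum_triangle_exchange (big_cat_nat (n := a) (p := n)) //=; last by lia.
  rewrite [X in _ = _ + X]big1_seq ?addr0 => [|j]; last first.
    rewrite mem_index_iota => /andP[_ /andP[aj _]].
    by rewrite big1 // => i _; rewrite big1 // => K _; rewrite ltnNge aj mul0r.
  apply: eq_big_nat => j /andP[j0 ja]; rewrite sum_compsS; last by lia.
  rewrite big_distrr; apply: eq_bigr => i _ /=; rewrite subnAC big_distrr.
  apply: eq_bigr => K _ /=; rewrite ja comp_weight_cons /w2 !natrM; ring.
rewrite !sum_comps_two // -addrA; congr (_ + _).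
  have -> : cK a b [:: n] = (ThetaK [:: n] (a + b))%:R by [].
  by rewrite /comp_weight -scalerA !mulr_natl !scaler_nat.
pose D p q : Q := \sum_(1 <= i < n) \sum_(1 <= j < (n - i).+1) \sum_(K <- comps (n - i - j))
   (swap_defect a (a + b) (p i j) (q i j))%:R * w2 i j K.
have DD : D (fun i _ => i) (fun _ j => j) = D (fun _ j => j) (fun i _ => i).
  rewrite /D sum_triangle_exchange; apply: eq_bigr => i _; apply: eq_bigr => j _.
  by rewrite subnAC; apply: eq_bigr => K _; rewrite /w2 (mulrC (E j)).
(* The defect sum is added to both sides, on one of them with [i] and [j] exchanged; the identity
   then holds term by term by [cK_two]. *)
apply/eqP; rewrite subr_eq -(inj_eq (addIr (D (fun _ j => j) (fun i _ => i)))) -{2}DD.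
rewrite addrAC /D -!big_split; apply/eqP/eq_big_nat => i /andP[i0 _].
rewrite -!big_split; apply: eq_big_nat => j /andP[j0 _].
rewrite -!big_split; apply: eq_bigr => K _ /=.
rewrite wcomp2 mulrA -natrM -!mulrDl.
have -> : (cK a b (i :: j :: K) * (wK (i :: j :: K))%:R) *: eK N (i :: j :: K) =
   (cK a b (i :: j :: K) * (i * j.-1)%:R) *: w2 i j K.
  have := wcomp2 i j K; rewrite /comp_weight -/(eK N _) => e.
  by rewrite -!scalerA !scaler_nat -mulr_natl e mulr_natl.
by rewrite mulrDl !mulr_natl -!scaler_nat -!scalerDl cK_two // natrM.
Qed.

(** Every graph in the clique recursion is a tadpole, since the path of length [b] and the further
    edges from [ext] form one tail. *)
Lemma chrom_sym_cpcE a b c :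
  chrom_sym (cpc_adj a.+1 b c.+2) N =
  (a`!)%:R *: \sum_(K <- comps (a.+1 + b + c.+2 - 1)) (cK a.+1 b K * (wK K)%:R) *: eK N K.
Proof.
rewrite chrom_sym_cpc scaler_nat; congr (_ *+ _).
pose x (i : 'I_N) : Q := 'X_i.
have tadpoleM m : \sum_i iter m (ext x) (iter b (ext x) (cycle_rooted x c.+1)) i =
    theta_sum E (m + b) c.+1.
  by rewrite -(tadpoleE esym_avoid_mesym) /tadpole -iterD.
rewrite -clique_combination //; last by lia.
rewrite clique_sum_ext tadpoleM /theta_sum; congr (_ - _).
  by rewrite (_ : (a + b + c.+1).+1 = a.+1 + b + c.+2 - 1)%N; last by lia.
apply: eq_big_nat => j /andP[j0 ja]; rewrite esym_avoid_mesym tadpoleM /theta_sum.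
rewrite (_ : (a - j + b + c.+1).+1 = a.+1 + b + c.+2 - 1 - j)%N; last by lia.
by rewrite (_ : (a - j + b).+1 = a.+1 + b - j)%N; last by lia.
Qed.

(** * Positivity *)

Lemma e_positive_comps n (coef : seq nat -> rat) :
  (forall K, is_composition n K -> 0 <= coef K) ->
  e_positive N n (\sum_(K <- comps n) coef K *: eK N K).
Proof.
(* e_K depends only on the multiset of parts, so a partition collects the coefficients of all its
   rearrangements. *)
move=> coef0; exists (fun la => \sum_(K <- comps n | sort geq K == la) coef K); split.
  move=> la; rewrite big_seq_cond; apply: sumr_ge0 => K /andP[+ _].
  by rewrite mem_comps; apply: coef0.
rewrite sum_compE.
transitivity (\sum_(la <- comps n) \sum_(K <- comps n | sort geq K == la) coef K *: eK N la).
  rewrite (exchange_big_dep xpredT) //=; apply: eq_big_seq => K; rewrite mem_comps => KP.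
  rewrite (eq_bigl (pred1 (sort geq K))) => [|la]; last by rewrite /= eq_sym.
  have sortK : perm_eq (sort geq K) K by rewrite perm_sort.
  rewrite -big_filter filter_pred1_uniq ?big_seq1 ?comps_uniq //.
    by congr (_ *: _); apply/esym/perm_big.
  by move: KP; rewrite mem_comps /is_composition all_sort !sumnE (perm_big _ sortK).
apply: eq_bigr => la _; case: ifPn => [_|nsorted]; first by rewrite scaler_suml.
rewrite big1 // => K /eqP e; case/negP: nsorted; rewrite -e.
by apply: sort_sorted => i j; apply: leq_total.
Qed.

End Assembly.

Lemma cK_ge0 a b K : 0 <= cK a b K.
Proof.
rewrite /cK; case: ifP => _ //; case: ifP => // /and3P[_ k1a k2ab].
set k1 := nth _ _ _ in k1a *; set k2 := nth _ _ _ in k2ab *.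
apply: addr_ge0; first by rewrite -addrA -opprD -natrD subr_ge0 ler_nat.
case: (posnP k2) => [k20|k2_gt0].
  (* [k2 = 0] forces [a = 0] and hence [k1 = 0], so the numerator vanishes. *)
  by rewrite k20 (_ : k1 = 0%N) ?subrr ?mul0r //; lia.
apply: divr_ge0; rewrite subr_ge0 ?ler1n // ler_nat; lia.
Qed.

Theorem theorem3p3 (a b c : nat) :
  (1 <= a)%N -> (2 <= c)%N ->
  let n := (a + b + c - 1)%N in
  (forall N : nat,
     chrom_sym (cpc_adj a b c) N =
     (a.-1)`!%:R *: sum_comp n (fun K => (cK a b K * (wK K)%:R) *: eK N K))
  /\ (forall K : seq nat, is_composition n K ->
        0 <= (a.-1)`!%:R * cK a b K * (wK K)%:R :> rat)
  /\ (forall N : nat, e_positive N n (chrom_sym (cpc_adj a b c) N)).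
Proof.
case: a => // a _; case: c => [|[|c]] // _ n.
have coef_ge0 K : 0 <= (a.+1.-1)`!%:R * cK a.+1 b K * (wK K)%:R :> rat.
  by rewrite !mulr_ge0 ?cK_ge0.
split=> [N|]; first by rewrite sum_compE chrom_sym_cpcE.
split=> [K _ //|N]; rewrite chrom_sym_cpcE scaler_sumr.
under eq_bigr do rewrite scalerA mulrA.
by apply: e_positive_comps.
Qed.
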